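(* Let $a$ be a complex number not equal to a non-zero integer. Then $$\sum_{k=1}^{\infty}\frac{1}{k(k^2-a^2)}=2\sum_{n=1}^{\infty}\frac{(-1)^{n-1}}{n^3\binom{2n}{n}^5}\,\frac{p(n,a)}{(n^2-a^2)(4n^2-a^2)}\prod_{m=1}^{n-1}\left(\frac{(1-a^2/m^2)^2}{1-a^2/(n+m)^2}\right),$$ where $$p(n,a)=a^4-a^2(62n^2-40n+8)+n^2(205n^2-160n+32).$$
   Context: An empty product (the case $n=1$) equals $1$. *)

(* Defs.v *)
From HB Require Import structures.
From mathcomp Require Import all_boot all_order all_algebra.
From mathcomp Require Import complex.
From mathcomp Require Import all_classical all_reals all_analysis.

Set Implicit Arguments.
Unset Strict Implicit.
Unset Printing Implicit Defensive.

Import Order.TTheory GRing.Theory Num.Theory.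
Import numFieldNormedType.Exports.

Local Open Scope classical_set_scope.
Local Open Scope ring_scope.
Local Open Scope complex_scope.

(* Sums start at index 1. The regular module R[i]^o is what carries the
   topology of the complex modulus; R[i] itself has no topological instance. *)
Definition complex_series_sum (R : realType) (f : nat -> R[i]) (s : R[i]) : Prop :=
  (fun N : nat => (\sum_(1 <= k < N.+1) f k : R[i]^o)) @ \oo --> (s : R[i]^o).

Definition p (R : realType) (n : nat) (a : R[i]) : R[i] :=
  a ^+ 4 - a ^+ 2 * (62 * n%:R ^+ 2 - 40 * n%:R + 8)
  + n%:R ^+ 2 * (205 * n%:R ^+ 2 - 160 * n%:R + 32).

(* Main.v *)
Require Import Defs.
From HB Require Import structures.
From mathcomp Require Import all_boot all_order all_algebra.
From mathcomp Require Import complex.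
From mathcomp Require Import all_classical all_reals all_analysis.
From mathcomp Require Import ring lra zify.

Import Order.TTheory GRing.Theory Num.Theory.
Import numFieldNormedType.Exports.

Local Open Scope ring_scope.
Local Open Scope complex_scope.

(** Put P(j) = \prod_(i <= j) i^2 (i^2 - a^2).  The well-poised kernel
      F(n,k) = (-1)^n P(n)^2 / (n!^2 (2n)!) (3n + 2k + 2) P(n+k) / P(2n+k+1)
    has F(0,k) = 2 / ((k+1) ((k+1)^2 - a^2)) and a WZ mate G, that is
    F(n+1,k) - F(n,k) = G(n,k+1) - G(n,k), with G(n,0) equal to four times the
    term of index n + 1 on the right-hand side.  Summing over n < N and k < K,
      \sum_n G(n,0) = \sum_k F(0,k) - \sum_k F(N,k) + \sum_n G(n,K).
    Since |F(n,k)| <= C 2^-n / (k+1)^2 and |G(n,k)| <= C_n / (k+1), letting first K and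
    then N tend to infinity gives the identity.  The decay in n comes from
    (n+1)(n+k+1) <= (2n+k+2)^2 / 4: up to factors |j^2 - a^2| / j^2 and their inverses
    for j > n, which tend to 1, it bounds |F(n+1,k) / F(n,k)| by 5/1024. *)

(** * The WZ pair: term ratios, the WZ equation and its boundary values *)

Section WZPair.
Variables (C : numFieldType) (a : C).
Hypothesis a_nat : forall j : nat, (0 < j)%N -> j%:R ^+ 2 - a ^+ 2 != 0.

Definition wp_factor (j : nat) : C := j%:R ^+ 2 * (j%:R ^+ 2 - a ^+ 2).

Definition wp_prod (j : nat) : C := \prod_(1 <= i < j.+1) wp_factor i.

Definition wzF (n k : nat) : C :=
  (-1) ^+ n * wp_prod n ^+ 2 / (n`!%:R ^+ 2 * (2 * n)`!%:R)
  * (3 * n + 2 * k + 2)%:R * wp_prod (n + k) / wp_prod (2 * n + k).+1.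

(** The ratio between n + 1 and n of the prefactor (-1)^n P(n)^2 / (n!^2 (2n)!) of F, which does not
    depend on k. *)
Definition wz_step (n : nat) : C :=
  - n.+1%:R * (n.+1%:R ^+ 2 - a ^+ 2) ^+ 2 / (2 * (2 * n + 1)%:R).

(* With y = k + 3(n+1)/2, the substitution y -> -y exchanges the two factors
   [wp_factor (n + k).+1] and [wp_factor (2 * n + k).+2] of the WZ equation (the identity
   [key] in [wz_pair]), which forces this polynomial, of degree two in k. *)
Definition wz_quad (n k : nat) : C :=
  (5 / 4 * n.+1%:R ^+ 2 - a ^+ 2 / 2
   + 2 * n.+1%:R * (k%:R + (3 * n + 1)%:R / 2)
   + (k%:R + (3 * n + 1)%:R / 2) ^+ 2) / (2 * n + 1)%:R.

(** The summand with [wz_step] is F(n+1,k-1) rewritten through F(n,k), so that it also makes sense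
    at k = 0. Hence in G(n,k+1) it equals F(n+1,k) and cancels that term of the WZ equation. *)
Definition wzG (n k : nat) : C :=
  wzF n k / (3 * n + 2 * k + 2)%:R
  * (wz_quad n k
     + wz_step n * (3 * n + 2 * k + 3)%:R / wp_factor (2 * n + k).+2).

Lemma natS_neq0 (n : nat) : n.+1%:R != 0 :> C.
Proof. by rewrite pnatr_eq0. Qed.

Lemma wp_factor_neq0 j : (0 < j)%N -> wp_factor j != 0.
Proof.
by move=> j0; rewrite mulf_neq0 ?a_nat// expf_neq0// pnatr_eq0 -lt0n.
Qed.

Lemma wp_prodS j : wp_prod j.+1 = wp_prod j * wp_factor j.+1.
Proof. by rewrite /wp_prod big_nat_recr. Qed.

Lemma wp_prod_neq0 j : wp_prod j != 0.
Proof.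
elim: j => [|j IH]; first by rewrite /wp_prod big_geq// oner_neq0.
by rewrite wp_prodS mulf_neq0// wp_factor_neq0.
Qed.

(** For the side conditions of [field], whose normalised denominators [ring] identifies with
    positive integers. *)
Lemma neq0_eq_natS (x : C) (n : nat) : x = n.+1%:R -> x != 0.
Proof. by move=> ->; exact: natS_neq0. Qed.

Lemma fact_neq0 (n : nat) : n`!%:R != 0 :> C.
Proof. by rewrite pnatr_eq0 -lt0n fact_gt0. Qed.

Lemma wzFS n k : wzF n.+1 k =
  wzF n k * (wz_step n * (3 * n + 2 * k + 5)%:R / (3 * n + 2 * k + 2)%:R
   * wp_factor (n + k).+1 / (wp_factor (2 * n + k).+2 * wp_factor (2 * n + k).+3)).
Proof.
rewrite /wzF /wz_step.
rewrite (_ : (2 * n.+1 + k).+1 = (2 * n + k).+3)%N; last lia.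
rewrite (_ : (2 * n.+1) = (2 * n).+2)%N; last lia.
rewrite (_ : (n.+1 + k) = (n + k).+1)%N; last lia.
rewrite !wp_prodS !factS !natrM exprS.
have f0 := fact_neq0 n; have f1 := fact_neq0 (2 * n).
have p0 := wp_prod_neq0 (2 * n + k); have p1 := wp_factor_neq0 (2 * n + k).+1 isT.
have p2 := wp_factor_neq0 (2 * n + k).+2 isT.
have p3 := wp_factor_neq0 (2 * n + k).+3 isT.
have -> : wp_factor n.+1 = n.+1%:R ^+ 2 * (n.+1%:R ^+ 2 - a ^+ 2) by [].
(* Products, factorials and sign become variables, which leaves an identity of rational
   functions. *)
move: (wp_prod n) (wp_prod (n + k)) (wp_prod (2 * n + k)) p0 (wp_factor (2 * n + k).+1)
  (wp_factor (2 * n + k).+2) (wp_factor (2 * n + k).+3) (wp_factor (n + k).+1) p1 p2 p3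
  (n`!%:R) ((2 * n)`!%:R) f0 f1 ((-1)^+n).
move=> x1 x2 x3 p0 x4 x5 x6 x7 p1 p2 p3 x8 x9 f0 f1 x10.
field; rewrite p0 p1 p2 p3 f0 f1 /=; apply/and4P; split.
- by apply: (@neq0_eq_natS _ (3 * n + 2 * k + 1)); ring.
- by apply: (@neq0_eq_natS _ (2 * n)); ring.
- by apply: (@neq0_eq_natS _ (2 * n).+1); ring.
- by apply: (@neq0_eq_natS _ n); ring.
Qed.

Lemma wzF_shift n k : wzF n k.+1 =
  wzF n k * ((3 * n + 2 * k + 4)%:R / (3 * n + 2 * k + 2)%:R
             * wp_factor (n + k).+1 / wp_factor (2 * n + k).+2).
Proof.
rewrite /wzF (addnS n k) (addnS (2 * n) k) !wp_prodS.
have f0 := fact_neq0 n; have f1 := fact_neq0 (2 * n).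
have p0 := wp_prod_neq0 (2 * n + k); have p1 := wp_factor_neq0 (2 * n + k).+1 isT.
have p2 := wp_factor_neq0 (2 * n + k).+2 isT.
move: (wp_prod n) (wp_prod (n + k)) (wp_prod (2 * n + k)) p0 (wp_factor (2 * n + k).+1)
  (wp_factor (2 * n + k).+2) (wp_factor (n + k).+1) p1 p2
  (n`!%:R) ((2 * n)`!%:R) f0 f1 ((-1)^+n).
move=> x1 x2 x3 p0 x4 x5 x6 p1 p2 x8 x9 f0 f1 x10.
field; rewrite p0 p1 p2 f0 f1 /= andbT.
by apply: (@neq0_eq_natS _ (3 * n + 2 * k + 1)); ring.
Qed.

(** Once F(n+1,k) has cancelled, dividing by F(n,k) / (3n + 2k + 2) and multiplying by
    [wp_factor (2 * n + k).+2] leaves exactly the polynomial identity [key]. *)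
Lemma wz_pair n k : wzF n.+1 k - wzF n k = wzG n k.+1 - wzG n k.
Proof.
have key : wp_factor (n + k).+1 * wz_quad n k.+1
    - wp_factor (2 * n + k).+2 * (wz_quad n k - (3 * n + 2 * k + 2)%:R)
    = wz_step n * (3 * n + 2 * k + 3)%:R.
  rewrite /wp_factor /wz_quad /wz_step; field.
  by apply: (@neq0_eq_natS _ (2 * n)); ring.
rewrite /wzG wzFS wzF_shift (addnS (2 * n) k).
have p2 := wp_factor_neq0 (2 * n + k).+2 isT.
have p3 := wp_factor_neq0 (2 * n + k).+3 isT.
(* This is [key] solved for [wz_quad n k]; afterwards the remaining factors can be treated as
   independent variables. *)
have -> : wz_quad n k = (3 * n + 2 * k + 2)%:R + (wp_factor (n + k).+1 * wz_quad n k.+1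
   - wz_step n * (3 * n + 2 * k + 3)%:R) / wp_factor (2 * n + k).+2.
  by rewrite -key; field.
move: (wp_factor _) (wp_factor _) (wp_factor _) (wz_quad _ _) (wz_step _) (wzF _ _) p2 p3.
move=> x1 x2 x3 x4 x5 x6 p2 p3.
field; rewrite p2 p3 /=; apply/andP; split.
- by apply: (@neq0_eq_natS _ (3 * n + 2 * k + 1)); ring.
- by apply: (@neq0_eq_natS _ (3 * n + 2 * k + 3)); ring.
Qed.

Lemma wzF0 k : wzF 0 k = 2 * (1 / (k.+1%:R * (k.+1%:R ^+ 2 - a ^+ 2))).
Proof.
rewrite /wzF wp_prodS !muln0 !add0n fact0 /wp_prod big_geq//.
have p0 := wp_prod_neq0 k; have p1 := a_nat k.+1 isT.
rewrite -/(wp_prod k) /wp_factor.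
move: (wp_prod k) p0 p1 => x p0 p1.
field.
move: p1; rewrite p0 [1 + _]addrC natr1 => -> /=.
by rewrite natS_neq0.
Qed.

(** Each factor is [wp_factor i] divided by i^4. *)
Lemma prod_one_sub_sqr_div j :
  \prod_(1 <= i < j.+1) (1 - a ^+ 2 / i%:R ^+ 2) = wp_prod j / j`!%:R ^+ 4.
Proof.
elim: j => [|j IH]; first by rewrite /wp_prod !big_geq// fact0 expr1n divr1.
rewrite big_nat_recr//= IH wp_prodS factS natrM /wp_factor.
have f0 := fact_neq0 j; have h0 := natS_neq0 j.
move: (j`!%:R) f0 (wp_prod j) j.+1%:R h0 => x x0 y z z0.
by field; rewrite z0 x0.
Qed.

(** The indices n + 1 + i run from n + 2 to 2n + 1, so the product is a quotient of two initial
    products of the previous kind. *)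
Lemma prod_one_sub_sqr_div_shift n :
  \prod_(1 <= i < n.+1) (1 - a ^+ 2 / (n.+1 + i)%:R ^+ 2) =
  (wp_prod (2 * n).+1 / (2 * n).+1`!%:R ^+ 4) / (wp_prod n.+1 / n.+1`!%:R ^+ 4).
Proof.
rewrite -!prod_one_sub_sqr_div.
rewrite (@big_cat_nat _ _ _ n.+2 1%N (2 * n).+2)//=; last lia.
rewrite [X in _ = X / _]mulrC mulfK; last first.
  rewrite prod_one_sub_sqr_div; apply: mulf_neq0; first exact: wp_prod_neq0.
  by apply: invr_neq0; apply: expf_neq0; exact: fact_neq0.
rewrite (_ : n.+2 = (1 + n.+1)%N); last lia.
rewrite [in RHS]big_addn (_ : ((2 * n).+2 - n.+1) = n.+1)%N; last lia.
by apply: eq_bigr => i _; rewrite addnC.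
Qed.

Lemma wzG0 n : wzG n 0 = 4 *
  ((-1) ^+ n / (n.+1%:R ^+ 3 * 'C(2 * n.+1, n.+1)%:R ^+ 5)
   * ((a ^+ 4 - a ^+ 2 * (62 * n.+1%:R ^+ 2 - 40 * n.+1%:R + 8)
       + n.+1%:R ^+ 2 * (205 * n.+1%:R ^+ 2 - 160 * n.+1%:R + 32))
      / ((n.+1%:R ^+ 2 - a ^+ 2) * (4 * n.+1%:R ^+ 2 - a ^+ 2)))
   * \prod_(1 <= m < n.+1) ((1 - a ^+ 2 / m%:R ^+ 2) ^+ 2
                  / (1 - a ^+ 2 / (n.+1 + m)%:R ^+ 2))).
Proof.
rewrite prodf_div prodrXl prod_one_sub_sqr_div prod_one_sub_sqr_div_shift.
have f0 := fact_neq0 n; have f1 := fact_neq0 (2 * n).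
(* The central binomial as (2n+2)! / (n+1)!^2, with the top factors split off so that only n! and
   (2n)! remain, as in F(n,0). *)
have -> : 'C(2 * n.+1, n.+1)%:R
    = (2 * n).+2%:R * ((2 * n).+1%:R * (2 * n)`!%:R) / (n.+1%:R * n`!%:R) ^+ 2 :> C.
  have := @bin_fact (2 * n.+1) n.+1.
  rewrite (_ : 2 * n.+1 - n.+1 = n.+1)%N; last lia.
  rewrite (_ : 2 * n.+1 = (2 * n).+2)%N; last lia.
  move=> /(_ _)/(congr1 (fun x => x%:R : C)); rewrite !factS !natrM -expr2 => <-; last lia.
  by rewrite mulfK// expf_neq0// mulf_neq0 ?natS_neq0.
rewrite /wzG /wzF !addn0 !wp_prodS !factS !natrM.
have -> : wp_factor n.+1 = n.+1%:R ^+ 2 * (n.+1%:R ^+ 2 - a ^+ 2) by [].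
have p1 := a_nat n.+1 isT; have p2 := a_nat (2 * n).+2 isT.
rewrite /wz_step /wz_quad.
rewrite [wp_factor (2 * n).+2]/wp_factor.
have p3 := wp_prod_neq0 n; have p4 := wp_prod_neq0 (2 * n).
have p5 := wp_factor_neq0 (2 * n).+1 isT.
move: (n`!%:R) ((2 * n)`!%:R) f0 f1 (wp_prod n) (wp_prod (2 * n))
  (wp_factor _) p3 p4 p5 ((-1) ^+ n).
move=> x1 x2 f0 f1 x3 x4 x5 p3 p4 p5 x6.
field.
have -> : 1 + n%:R = n.+1%:R :> C by rewrite addrC natr1.
(* The second denominator is j^2 - a^2 at j = 2n + 2, hence nonzero by [a_nat]. *)
have -> : 4 * n.+1%:R ^+ 2 - a ^+ 2 = (2 * n).+2%:R ^+ 2 - a ^+ 2 by ring.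
rewrite f0 natS_neq0 p1 p3 f1 p5 p4 p2 /=; apply/and3P; split.
- by apply: (@neq0_eq_natS _ (2 * n)); ring.
- by apply: (@neq0_eq_natS _ (2 * n).+1); ring.
- by apply: (@neq0_eq_natS _ (3 * n).+1); ring.
Qed.

(** Induction on N: the WZ equation at n = N, summed over k < K, telescopes to G(N,K) - G(N,0). *)
Lemma wz_sum N K :
  \sum_(0 <= n < N) wzG n 0 = \sum_(0 <= k < K) wzF 0 k
    - \sum_(0 <= k < K) wzF N k + \sum_(0 <= n < N) wzG n K.
Proof.
elim: N => [|N IH]; first by rewrite !(big_geq (leqnn 0)) subrr addr0.
rewrite !(big_nat_recr N)//= IH.
have : \sum_(0 <= k < K) (wzF N.+1 k - wzF N k) = wzG N K - wzG N 0.
  by rewrite -telescope_sumr//; apply: eq_bigr => k _; exact: wz_pair.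
rewrite sumrB => /eqP; rewrite subr_eq => /eqP ->.
by ring.
Qed.

End WZPair.

Arguments wzF {C}.
Arguments wzG {C}.
Arguments wp_factor {C}.
Arguments wz_step {C}.
Arguments wz_quad {C}.

(** * The real-valued modulus and convergence of complex series *)

Section ComplexModulus.
Variable R : realType.
Implicit Types x y : R[i].

(** The norm on [R[i]] takes values in [R[i]]; this passes to the real modulus, in which all
    estimates are made. *)
Lemma cnormE x : `|x| = (Normc.normc x)%:C.
Proof. by []. Qed.

Lemma normc_ge0 x : 0 <= Normc.normc x.
Proof. by rewrite -lecR -cnormE rmorph0 normr_ge0. Qed.

Lemma normc_gt0 x : x != 0 -> 0 < Normc.normc x.
Proof. by rewrite -ltcR -cnormE rmorph0 normr_gt0. Qed.

Lemma normcD x y : Normc.normc (x + y) <= Normc.normc x + Normc.normc y.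
Proof. by rewrite -lecR rmorphD/= -!cnormE ler_normD. Qed.

Lemma normc_opp x : Normc.normc (- x) = Normc.normc x.
Proof. by apply: complexI; rewrite -!cnormE normrN. Qed.

Lemma normc_nat (n : nat) : Normc.normc (n%:R : R[i]) = n%:R.
Proof. by apply: complexI; rewrite -cnormE normr_nat rmorph_nat. Qed.

Lemma normcX x n : Normc.normc (x ^+ n) = Normc.normc x ^+ n.
Proof. by apply: complexI; rewrite -cnormE normrX cnormE rmorphXn. Qed.

Lemma normc_sum (f : nat -> R[i]) (K : nat) :
  Normc.normc (\sum_(0 <= k < K) f k) <= \sum_(0 <= k < K) Normc.normc (f k).
Proof.
elim: K => [|K IH]; first by rewrite !big_geq// Normc.normc0.
by rewrite !big_nat_recr//= (le_trans (normcD _ _))// lerD2r.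
Qed.

Lemma sum_inv_sqr_le (K : nat) :
  \sum_(0 <= k < K) (k.+1%:R ^+ 2)^-1 <= 2 :> R.
Proof.
(* The bound 2 alone is not inductive; the correction 2 / (K + 1) leaves room for the next term. *)
suff : \sum_(0 <= k < K) (k.+1%:R ^+ 2)^-1 <= 2 - 2 / K.+1%:R :> R.
  by move=> /le_trans -> //; rewrite gerBl divr_ge0.
elim: K => [|K IH]; first by rewrite big_geq// divr1 subrr.
rewrite big_nat_recr//= (le_trans (lerD IH (lexx _)))//.
rewrite -subr_ge0 -(natr1 K.+1) -(natr1 K); set x : R := K%:R.
have x0 : 0 <= x by [].
have -> : 2 - 2 / (x + 1 + 1) - (2 - 2 / (x + 1) + ((x + 1) ^+ 2)^-1)
  = x / ((x + 1 + 1) * (x + 1) ^+ 2).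
  by field; apply/andP; split; lra.
by rewrite divr_ge0// mulr_ge0// ?exprn_ge0//; lra.
Qed.

Lemma cvgn_series_inv_sqr (u : nat -> R) (M : R) :
  (forall k, `|u k| <= M * (k.+1%:R ^+ 2)^-1) -> cvgn (series u).
Proof.
move=> uM.
have v0 k : 0 <= M * (k.+1%:R ^+ 2)^-1 by exact: le_trans (uM k).
have M0 : 0 <= M by have := v0 0%N; rewrite expr1n invr1 mulr1.
apply: (@normed_cvg _ R^o); apply: (series_le_cvg _ v0 uM) => //.
apply: nondecreasing_is_cvgn; first exact: nondecreasing_series.
exists (M * 2) => _ [n _ <-]; rewrite /series/= -mulr_sumr.
by rewrite ler_wpM2l// sum_inv_sqr_le.
Qed.

Lemma normcRe x : `|complex.Re x| <= Normc.normc x.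
Proof.
by case: x => c d /=; rewrite -sqrtr_sqr ler_wsqrtr// lerDl sqr_ge0.
Qed.

Lemma normcIm x : `|complex.Im x| <= Normc.normc x.
Proof.
by case: x => c d /=; rewrite -sqrtr_sqr ler_wsqrtr// lerDr sqr_ge0.
Qed.

Lemma normc_le_ReIm x : Normc.normc x <= `|complex.Re x| + `|complex.Im x|.
Proof.
case: x => c d /=; rewrite -[leRHS]ger0_norm ?addr_ge0// -sqrtr_sqr ler_wsqrtr//.
rewrite sqrrD !real_normK ?num_real//; have := normr_ge0 c; have := normr_ge0 d; nra.
Qed.

(** Real and imaginary parts converge by comparison with the inverse squares, and the modulus is at
    most the sum of their absolute values. *)
Lemma complex_series_exists (f : nat -> R[i]) (M : R) :
  (forall k, Normc.normc (f k) <= M * (k.+1%:R ^+ 2)^-1) ->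
  exists S : R[i],
    (Normc.normc (\sum_(0 <= k < K) f k - S) @[K --> \oo] --> (0 : R))%classic.
Proof.
move=> fM.
have cre := @cvgn_series_inv_sqr (fun k => complex.Re (f k)) M
  (fun k => le_trans (normcRe _) (fM k)).
have cim := @cvgn_series_inv_sqr (fun k => complex.Im (f k)) M
  (fun k => le_trans (normcIm _) (fM k)).
have sre K : complex.Re (\sum_(0 <= k < K) f k) = series (fun k => complex.Re (f k)) K.
  rewrite /series/=; elim: K => [|K IH]; first by rewrite !big_geq.
  by rewrite !big_nat_recr//= -IH; case: (\sum_(_ <= _ < _) _) (f K) => ? ? [].
have sim K : complex.Im (\sum_(0 <= k < K) f k) = series (fun k => complex.Im (f k)) K.
  rewrite /series/=; elim: K => [|K IH]; first by rewrite !big_geq.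
  by rewrite !big_nat_recr//= -IH; case: (\sum_(_ <= _ < _) _) (f K) => ? ? [].
set u := limn (series (fun k => complex.Re (f k))).
set v := limn (series (fun k => complex.Im (f k))).
exists (u +i* v).
apply: (@squeeze_cvgr _ _ _ _ (fun=> 0)
  (fun K => `|series (fun k => complex.Re (f k)) K - u|
    + `|series (fun k => complex.Im (f k)) K - v|)).
- apply: nearW => K; rewrite normc_ge0/= -sre -sim.
  apply: le_trans (normc_le_ReIm _) _.
  by case: (\sum_(_ <= _ < _) _).
- exact: cvg_cst.
- rewrite -[X in (_ --> X)%classic](addr0 (0 : R)); apply: cvgD.
  + by rewrite -(normr0 R); apply: cvg_norm; apply/subr_cvg0.
  + by rewrite -(normr0 R); apply: cvg_norm; apply/subr_cvg0.
Qed.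

(** Passes from the WZ sums, which start at 0 and carry a constant factor c, to the series of the
    theorem, which start at 1. *)
Lemma complex_series_sum_scaled (f g : nat -> R[i]) (c S : R[i]) :
  c != 0 -> (forall k, g k = c * f k.+1) ->
  (Normc.normc (\sum_(0 <= k < K) g k - S) @[K --> \oo] --> (0 : R))%classic ->
  complex_series_sum f (S / c).
Proof.
move=> c0 gf gS; rewrite /complex_series_sum; apply/cvgrPdist_le => /= -[e e'].
(* The tolerance is itself complex; its positivity forces the imaginary part to vanish. *)
rewrite ltcE /= => /andP[/eqP -> e0].
have ec : 0 < e * Normc.normc c by rewrite mulr_gt0// normc_gt0.
move/cvgrPdist_le: gS => /(_ _ ec); apply: filterS => K.
rewrite sub0r normrN ger0_norm ?normc_ge0// => h.
rewrite big_add1 /=.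
have -> : \sum_(0 <= i < K) f i.+1 = c^-1 * \sum_(0 <= k < K) g k.
  by rewrite mulr_sumr; apply: eq_bigr => k _; rewrite gf mulKf.
rewrite mulrC -mulrBr -[X in _ <= X]/(e%:C) cnormE lecR.
rewrite Normc.normcM Normc.normcV ler_pdivrMl ?normc_gt0// mulrC.
by rewrite -normc_opp opprB.
Qed.

End ComplexModulus.

Arguments cnormE {R}.
Arguments normc_ge0 {R}.
Arguments normc_gt0 {R} [x].
Arguments normcD {R}.
Arguments normc_opp {R}.
Arguments normc_nat {R}.
Arguments normcX {R}.
Arguments complex_series_exists {R f M}.
Arguments complex_series_sum_scaled {R f g c S}.

(** * Decay of F and G *)

Section WZBounds.
Variables (R : realType) (a : R[i]).
Hypothesis a_nat : forall j : nat, (0 < j)%N -> j%:R ^+ 2 - a ^+ 2 != 0.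

Let dist (j : nat) : R := Normc.normc (j%:R ^+ 2 - a ^+ 2).

Lemma dist_gt0 j : (0 < j)%N -> 0 < dist j.
Proof. by move=> j0; exact: normc_gt0 (a_nat j j0). Qed.

Lemma dist_le j : dist j <= j%:R ^+ 2 + Normc.normc a ^+ 2.
Proof.
by rewrite /dist (le_trans (normcD _ _))// normc_opp !normcX normc_nat.
Qed.

Lemma dist_ge j : j%:R ^+ 2 - Normc.normc a ^+ 2 <= dist j.
Proof.
rewrite lerBlDr -normcX /dist.
have := normcD (j%:R ^+ 2 - a ^+ 2) (a ^+ 2).
by rewrite subrK !normcX normc_nat.
Qed.

Lemma sqr_natr_ge1 (j : nat) : (0 < j)%N -> 1 <= j%:R ^+ 2 :> R.
Proof. by move=> j0; rewrite exprn_ege1// ler1n. Qed.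

Lemma dist_le_sqr : exists2 A : R, 0 <= A &
  forall j, (0 < j)%N -> dist j <= A * j%:R ^+ 2.
Proof.
exists (1 + Normc.normc a ^+ 2); first by rewrite addr_ge0 ?exprn_ge0 ?normc_ge0.
move=> j /sqr_natr_ge1; have := dist_le j.
have : 0 <= Normc.normc a ^+ 2 by rewrite exprn_ge0 ?normc_ge0.
move: (j%:R ^+ 2) (Normc.normc a ^+ 2) => x y; nra.
Qed.

Lemma dist_eventually : exists J : nat, forall j, (J < j)%N ->
  dist j <= 2 * j%:R ^+ 2 /\ j%:R ^+ 2 <= 2 * dist j.
Proof.
have a0 : 0 <= 2 * Normc.normc a ^+ 2 by rewrite mulr_ge0// exprn_ge0// normc_ge0.
(* For j beyond this bound, j^2 >= j >= 2 |a|^2, so |a|^2 is at most half of j^2. *)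
exists (Num.bound (2 * Normc.normc a ^+ 2)) => j Jj.
have h : 2 * Normc.normc a ^+ 2 <= j%:R ^+ 2.
  apply: le_trans (ltW (archi_boundP a0)) _.
  apply: (@le_trans _ _ j%:R); first by rewrite ler_nat ltnW.
  have j1 : 1 <= j%:R :> R by rewrite ler1n (leq_ltn_trans _ Jj).
  by move: (j%:R) j1 => x; nra.
by have := dist_le j; have := dist_ge j; split; lra.
Qed.

Lemma sqr_le_dist : exists2 D : R, 0 <= D &
  forall j, (0 < j)%N -> j%:R ^+ 2 <= D * dist j.
Proof.
have [J hJ] := dist_eventually.
(* The 2 serves j > J; the sum dominates each of the finitely many remaining ratios. *)
pose D := 2 + \sum_(1 <= i < J.+1) i%:R ^+ 2 / dist i.
have q0 i : 0 <= i%:R ^+ 2 / dist i by rewrite divr_ge0 ?exprn_ge0 ?normc_ge0.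
have s0 : 0 <= \sum_(1 <= i < J.+1) i%:R ^+ 2 / dist i.
  by apply: sumr_ge0 => i _.
exists D => [|j j0]; first by rewrite addr_ge0.
have [Jj|jJ] := ltnP J j.
  apply: le_trans (hJ _ Jj).2 _; rewrite ler_wpM2r ?normc_ge0//.
  by rewrite lerDl.
rewrite -ler_pdivrMr ?dist_gt0// /D.
rewrite (bigD1_seq j) ?iota_uniq ?mem_index_iota ?j0//=.
by rewrite addrCA lerDl addr_ge0//; apply: sumr_ge0.
Qed.

Lemma normc_wp_factor j : Normc.normc (wp_factor a j) = j%:R ^+ 2 * dist j.
Proof. by rewrite /wp_factor Normc.normcM normcX normc_nat. Qed.

Lemma inv_wp_factor_le (D : R) j : (0 < j)%N -> j%:R ^+ 2 <= D * dist j ->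
  (Normc.normc (wp_factor a j))^-1 <= D / j%:R ^+ 4.
Proof.
move=> j0 jD; have d0 := dist_gt0 j j0.
have x0 : 0 < j%:R :> R by rewrite ltr0n.
rewrite normc_wp_factor invfM ler_pdivlMr ?exprn_gt0// mulrAC.
rewrite ler_pdivrMr// (_ : 4 = 2 + 2)%N// exprD mulKf ?expf_neq0 ?gt_eqF//.
Qed.

Lemma normc_wz_step_le (A : R) n : dist n.+1 <= A * n.+1%:R ^+ 2 ->
  Normc.normc (wz_step a n) <= A ^+ 2 / 2 * n.+1%:R ^+ 4.
Proof.
move=> h; rewrite /wz_step !Normc.normcM normc_opp Normc.normcV Normc.normcM.
rewrite !normc_nat -expr2 -/(dist n.+1).
have d0 : 0 <= dist n.+1 by exact: normc_ge0.
set x := n.+1%:R in h *.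
have x0 : 0 <= x by [].
have hx : 0 < x <= (2 * n + 1)%:R by rewrite ltr0n/= ler_nat; lia.
move: (2 * n + 1)%:R hx => y /andP[x1 xy].
rewrite ler_pdivrMr ?mulr_gt0//; last exact: lt_le_trans xy.
have h2 : dist n.+1 ^+ 2 <= A ^+ 2 * x ^+ 4.
  have -> : A ^+ 2 * x ^+ 4 = (A * x ^+ 2) ^+ 2 by ring.
  by rewrite ler_pXn2r// nnegrE// (le_trans d0).
apply: (@le_trans _ _ (y * (A ^+ 2 * x ^+ 4))); last first.
  by rewrite le_eqVlt; apply/orP; left; apply/eqP; field.
by apply: ler_pM => //; rewrite exprn_ge0.
Qed.

(** The comparison of |j^2 - a^2| with j^2 is asked only for j > n, so that the lemma serves both
    with constants valid for every j and with A = D = 2 for large n. *)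
Lemma normc_wzFS_le (A D : R) n k : 0 <= A -> 0 <= D ->
  (forall j, (n < j)%N -> dist j <= A * j%:R ^+ 2) ->
  (forall j, (n < j)%N -> j%:R ^+ 2 <= D * dist j) ->
  Normc.normc (wzF a n.+1 k) <=
    5 / 1024 * A ^+ 3 * D ^+ 2 * Normc.normc (wzF a n k).
Proof.
have nz : (n < (2 * n + k).+2)%N by lia.
move=> A0 D0 hA hD; rewrite wzFS// Normc.normcM mulrC.
rewrite ler_wpM2r ?normc_ge0//.
have nE (s q c f g h : R[i]) : Normc.normc (s * q / c * f / (g * h)) =
    Normc.normc s * (Normc.normc q / Normc.normc c) * Normc.normc f
    * ((Normc.normc g)^-1 * (Normc.normc h)^-1).
  by rewrite !Normc.normcM !Normc.normcV !Normc.normcM invfM !mulrA.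
rewrite nE !normc_nat.
have x0 : 0 <= n.+1%:R :> R by [].
have y0 : 0 <= (n + k).+1%:R :> R by [].
have z0 : 0 < (2 * n + k).+2%:R :> R by rewrite ltr0n.
have ez : (2 * n + k).+2%:R = n.+1%:R + (n + k).+1%:R :> R.
  by rewrite -natrD; congr (_%:R); lia.
have ew : (2 * n + k).+3%:R = (2 * n + k).+2%:R + 1 :> R by rewrite natr1.
have h1 := normc_wz_step_le A n (hA _ (ltnSn n)).
have h2 : (3 * n + 2 * k + 5)%:R / (3 * n + 2 * k + 2)%:R <= 5 / 2 :> R.
  rewrite ler_pdivrMr ?ltr0n ?addnS//.
  have : 0 <= n%:R :> R by []. have : 0 <= k%:R :> R by [].
  rewrite -(ler_pM2l (_ : 0 < 2))//; lra.
have h3 : Normc.normc (wp_factor a (n + k).+1) <= A * (n + k).+1%:R ^+ 4.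
  rewrite normc_wp_factor (_ : 4 = 2 + 2)%N// exprD mulrCA.
  by rewrite ler_wpM2l ?exprn_ge0// hA// ltnS leq_addr.
have h4 := inv_wp_factor_le D (2 * n + k).+2 isT (hD _ nz).
have h5 := inv_wp_factor_le D (2 * n + k).+3 isT (hD _ (leqW nz)).
set W := (2 * n + k).+3%:R in ew h5 *.
set Z := (2 * n + k).+2%:R in z0 ez ew h4 *.
set X := n.+1%:R in x0 ez h1 *; set Y := (n + k).+1%:R in y0 ez h3 *.
have W0 : 0 < W by rewrite ew; lra.
apply: (@le_trans _ _ (A ^+ 2 / 2 * X ^+ 4 * (5 / 2) * (A * Y ^+ 4)
   * (D / Z ^+ 4 * (D / W ^+ 4)))).
  have n1 := normc_ge0 (wz_step a n); have n2 := normc_ge0 (wp_factor a (n + k).+1).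
  have n3 : 0 <= (Normc.normc (wp_factor a (2 * n + k).+2))^-1 by rewrite invr_ge0 normc_ge0.
  have n4 : 0 <= (Normc.normc (wp_factor a (2 * n + k).+3))^-1 by rewrite invr_ge0 normc_ge0.
  have q0 : 0 <= (3 * n + 2 * k + 5)%:R / (3 * n + 2 * k + 2)%:R :> R by rewrite divr_ge0.
  have h12 := ler_pM n1 q0 h1 h2.
  have h123 := ler_pM (mulr_ge0 n1 q0) n2 h12 h3.
  exact: ler_pM (mulr_ge0 (mulr_ge0 n1 q0) n2) (mulr_ge0 n3 n4) h123 (ler_pM n3 n4 h4 h5).
(* As X + Y = Z, this is the inequality of arithmetic and geometric means. Its fourth power and Z <=
   W give the factor 1/256, which with 1/2 from [wz_step] and 5/2 from the linear factors makes
   5/1024. *)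
have XY : X * Y <= Z ^+ 2 / 4.
  by rewrite ez; have := sqr_ge0 (X - Y); nra.
have XY4 : X ^+ 4 * Y ^+ 4 <= Z ^+ 4 * W ^+ 4 / 256.
  apply: (@le_trans _ _ (Z ^+ 8 / 256)).
    have -> : X ^+ 4 * Y ^+ 4 = (X * Y) ^+ 4 by ring.
    have -> : Z ^+ 8 / 256 = (Z ^+ 2 / 4) ^+ 4 by field.
    by rewrite ler_pXn2r// nnegrE ?mulr_ge0// ?exprn_ge0// ltW.
  rewrite ler_pM2r; last lra.
  rewrite (exprD Z 4 4) ler_pM2l; last exact: exprn_gt0.
  by rewrite ler_pXn2r// ?nnegrE ?ltW//; rewrite ew; lra.
have Z4 : 0 < Z ^+ 4 by rewrite exprn_gt0. have W4 : 0 < W ^+ 4 by rewrite exprn_gt0.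
have -> : A ^+ 2 / 2 * X ^+ 4 * (5 / 2) * (A * Y ^+ 4) * (D / Z ^+ 4 * (D / W ^+ 4))
  = 5 / 4 * A ^+ 3 * D ^+ 2 * ((X ^+ 4 * Y ^+ 4) / (Z ^+ 4 * W ^+ 4)).
  by field; rewrite !gt_eqF.
have -> : 5 / 1024 * A ^+ 3 * D ^+ 2 = 5 / 4 * A ^+ 3 * D ^+ 2 / 256 by field.
rewrite ler_wpM2l ?mulr_ge0 ?exprn_ge0//.
by rewrite ler_pdivrMr ?mulr_gt0// [leRHS]mulrC.
Qed.

Lemma normc_wzF0_le (D : R) k : 0 <= D ->
  (forall j, (0 < j)%N -> j%:R ^+ 2 <= D * dist j) ->
  Normc.normc (wzF a 0 k) <= 2 * D * (k.+1%:R ^+ 2)^-1.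
Proof.
move=> D0 hD; rewrite wzF0// div1r Normc.normcM normc_nat Normc.normcV Normc.normcM normc_nat.
rewrite -mulrA ler_wpM2l// -/(dist k.+1) ler_pdivlMr ?exprn_gt0 ?ltr0n//.
have d0 := dist_gt0 k.+1 isT; have := hD k.+1 isT.
have x1 : 1 <= k.+1%:R :> R by rewrite ler1n.
move: (k.+1%:R : R) x1 => x x1 h.
have x0 : 0 < x by lra.
rewrite mulrC ler_pdivrMr ?mulr_gt0//; apply: le_trans h _.
by rewrite ler_wpM2l// ler_peMl// ltW.
Qed.

Lemma normc_wzF_le : exists2 C : R, 0 <= C & forall n k,
  Normc.normc (wzF a n k) <= C * 2^-1 ^+ n * (k.+1%:R ^+ 2)^-1.
Proof.
have [A A0 hA] := dist_le_sqr; have [D D0 hD] := sqr_le_dist.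
have [J hJ] := dist_eventually.
(* The summand 1 gives L >= 1, so powers of L are monotone in the exponent. *)
pose L : R := 1 + 5 / 1024 * A ^+ 3 * D ^+ 2.
have c0 : 0 <= 5 / 1024 * A ^+ 3 * D ^+ 2.
  apply: mulr_ge0; last exact: exprn_ge0.
  by apply: mulr_ge0; [lra | exact: exprn_ge0].
have L1 : 1 <= L by rewrite /L lerDl.
have early n k : Normc.normc (wzF a n.+1 k) <= L * Normc.normc (wzF a n k).
  apply: le_trans (normc_wzFS_le A D n k A0 D0 _ _) _.
  - by move=> j nj; apply: hA; exact: leq_trans nj.
  - by move=> j nj; apply: hD; exact: leq_trans nj.
  - by rewrite ler_wpM2r ?normc_ge0// lerDr.
move: L L1 early => {c0} L L1 early.
(* With A = D = 2 the factor is 5/1024 * 8 * 4 = 5/32, below 1/2. *)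
have late n k : (J <= n)%N -> Normc.normc (wzF a n.+1 k) <= 2^-1 * Normc.normc (wzF a n k).
  move=> Jn; apply: le_trans (normc_wzFS_le 2 2 n k _ _ _ _) _ => //.
  - by move=> j nj; have [] := hJ j (leq_ltn_trans Jn nj).
  - by move=> j nj; have [] := hJ j (leq_ltn_trans Jn nj).
  - by rewrite ler_wpM2r ?normc_ge0//; lra.
have earlyn n k : Normc.normc (wzF a n k) <= L ^+ n * Normc.normc (wzF a 0 k).
  elim: n => [|n IH]; first by rewrite mul1r.
  by rewrite exprS -mulrA (le_trans (early _ _))// ler_wpM2l// (le_trans _ L1).
(* At most J steps cost a factor L instead of 1/2; (2L)^J pays for them. *)
have all n k : Normc.normc (wzF a n k)
    <= (2 * L) ^+ J * 2^-1 ^+ n * Normc.normc (wzF a 0 k).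
  have [nJ|Jn] := leqP n J.
    apply: le_trans (earlyn n k) _; rewrite ler_wpM2r ?normc_ge0//.
    rewrite exprVn ler_pdivlMr ?exprn_gt0// mulrC -exprMn.
    by apply: ler_weXn2l => //; lra.
  elim: n Jn => // n IH; rewrite ltnS leq_eqVlt => /orP[/eqP Jn|Jn].
    apply: le_trans (late _ _ _) _; first by rewrite Jn.
    rewrite exprS mulrCA -!mulrA ler_wpM2l// mulrA.
    apply: le_trans (earlyn _ _) _; rewrite ler_wpM2r ?normc_ge0//.
    by rewrite exprVn -Jn ler_pdivlMr ?exprn_gt0// mulrC -exprMn.
  apply: le_trans (late _ _ (ltnW Jn)) _.
  by rewrite exprS mulrCA -!mulrA ler_wpM2l// mulrA IH.
exists ((2 * L) ^+ J * (2 * D)) => [|n k].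
  by rewrite mulr_ge0 ?exprn_ge0// mulr_ge0//; lra.
apply: le_trans (all n k) _.
have h := normc_wzF0_le D k D0 hD.
rewrite [leRHS](_ : _ = (2 * L) ^+ J * 2^-1 ^+ n * (2 * D * (k.+1%:R ^+ 2)^-1)); last by ring.
rewrite ler_wpM2l// mulr_ge0 ?exprn_ge0//; lra.
Qed.

Lemma normc_wz_quad_le n : exists2 Q : R, 0 <= Q & forall k,
  Normc.normc (wz_quad a n k) <= Q * k.+1%:R ^+ 2.
Proof.
pose M : R := (3 * n + 1)%:R / 2; pose m : R := n.+1%:R.
have M0 : 0 <= M by rewrite divr_ge0. have m0 : 0 <= m by [].
have na0 := normc_ge0 a.
exists (5 / 4 * m ^+ 2 + Normc.normc a ^+ 2 + 2 * m * (1 + M) + (1 + M) ^+ 2).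
  by rewrite !addr_ge0 ?mulr_ge0 ?sqr_ge0 ?addr_ge0.
move=> k; pose x : R := k%:R + M.
(* Apart from a^2 everything is real and nonnegative, and x <= (1 + M)(k + 1) bounds it by a
   multiple of (k + 1)^2. *)
have -> : wz_quad a n k = ((5 / 4 * m ^+ 2 + 2 * m * x + x ^+ 2)%:C - a ^+ 2 / 2)
    / (2 * n + 1)%:R.
  rewrite /wz_quad /x /M /m !(rmorphD, rmorphM, rmorphXn, fmorphV, rmorph_nat)/=.
  by congr (_ / _); ring.
have x0 : 0 <= x by rewrite addr_ge0.
have xk : x <= (1 + M) * k.+1%:R.
  by rewrite /x -natr1; have : 0 <= k%:R :> R by []; nra.
have k1 : 1 <= k.+1%:R :> R by rewrite ler1n.
rewrite Normc.normcM Normc.normcV normc_nat.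
apply: (@le_trans _ _ (Normc.normc ((5 / 4 * m ^+ 2 + 2 * m * x + x ^+ 2)%:C - a ^+ 2 / 2))).
  by rewrite ler_pdivrMr ?ltr0n ?addn1// ler_peMr ?normc_ge0// ler1n.
apply: le_trans (normcD _ _) _.
rewrite normc_opp Normc.normcM normcX Normc.normcV normc_nat.
have -> : Normc.normc (5 / 4 * m ^+ 2 + 2 * m * x + x ^+ 2)%:C
    = 5 / 4 * m ^+ 2 + 2 * m * x + x ^+ 2.
  apply: complexI; rewrite -cnormE ger0_norm// -[0]/(0%:C) lecR.
  by rewrite !addr_ge0 ?mulr_ge0 ?sqr_ge0.
move: (k.+1%:R : R) k1 xk => t t1 xt.
have h1 : 5 / 4 * m ^+ 2 <= 5 / 4 * m ^+ 2 * t ^+ 2.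
  by rewrite ler_peMr ?exprn_ege1// mulr_ge0 ?sqr_ge0.
have h2 : Normc.normc a ^+ 2 / 2 <= Normc.normc a ^+ 2 * t ^+ 2.
  by rewrite ler_wpM2l ?sqr_ge0// (@le_trans _ _ 1) ?exprn_ege1//; lra.
have h3 : 2 * m * x <= 2 * m * (1 + M) * t ^+ 2.
  rewrite -[leRHS]mulrA; apply: ler_wpM2l; first by rewrite mulr_ge0.
  by rewrite (le_trans xt)// ler_wpM2l ?addr_ge0// ler_eXnr.
have h4 : x ^+ 2 <= (1 + M) ^+ 2 * t ^+ 2.
  by rewrite -exprMn ler_pXn2r// nnegrE (le_trans x0).
by rewrite !mulrDl; lra.
Qed.

(** The quadratic growth of the bracket in k cancels the decay of F; the divisor 3n + 2k + 2
    supplies the remaining 1 / (k + 1). *)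
Lemma normc_wzG_le n : exists M : R, forall k,
  Normc.normc (wzG a n k) <= M / k.+1%:R.
Proof.
have [C C0 hC] := normc_wzF_le; have [D D0 hD] := sqr_le_dist.
have [Q Q0 hQ] := normc_wz_quad_le n.
pose s := Normc.normc (wz_step a n).
have s0 : 0 <= s by exact: normc_ge0.
exists (C * 2^-1 ^+ n * (Q + s * (3 * n + 3)%:R * D)) => k.
have k0 : 0 < k.+1%:R :> R by [].
have hF := hC n k.
have hf : (Normc.normc (wp_factor a (2 * n + k).+2))^-1 <= D.
  apply: le_trans (inv_wp_factor_le D (2 * n + k).+2 isT (hD (2 * n + k).+2 isT)) _.
  by rewrite ler_pdivrMr ?exprn_gt0 ?ltr0n// ler_peMr// exprn_ege1// ler1n.
have hk : (3 * n + 2 * k + 3)%:R <= (3 * n + 3)%:R * k.+1%:R ^+ 2 :> R.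
  by rewrite -natrX -natrM ler_nat; nia.
have hR : Normc.normc (wz_quad a n k + wz_step a n * (3 * n + 2 * k + 3)%:R
    / wp_factor a (2 * n + k).+2) <= (Q + s * (3 * n + 3)%:R * D) * k.+1%:R ^+ 2.
  rewrite (le_trans (normcD _ _))// mulrDl lerD//.
  rewrite Normc.normcM Normc.normcM Normc.normcV normc_nat -/s.
  rewrite [leRHS](_ : _ = (s * ((3 * n + 3)%:R * k.+1%:R ^+ 2)) * D); last by ring.
  by rewrite ler_pM ?mulr_ge0 ?invr_ge0 ?normc_ge0// ler_wpM2l.
rewrite /wzG Normc.normcM Normc.normcM Normc.normcV normc_nat.
have hq : ((3 * n + 2 * k + 2)%:R : R)^-1 <= k.+1%:R^-1.
  by rewrite lef_pV2 ?posrE ?ltr0n ?addnS// ler_nat; lia.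
have := ler_pM (mulr_ge0 (normc_ge0 _) _) (normc_ge0 _) (ler_pM (normc_ge0 _) _ hF hq) hR.
rewrite invr_ge0 => /(_ (ler0n _ _) (ler0n _ _)) /le_trans; apply.
rewrite le_eqVlt; apply/orP; left; apply/eqP.
by field; rewrite gt_eqF.
Qed.

End WZBounds.

(** * Passage to the limit, first in K and then in N *)

Section WZLimit.
Variables (R : realType) (a : R[i]).
Hypothesis a_nat : forall j : nat, (0 < j)%N -> j%:R ^+ 2 - a ^+ 2 != 0.

Lemma cvg_normc_wzG_sum N :
  (Normc.normc (\sum_(0 <= n < N) wzG a n K) @[K --> \oo] --> (0 : R))%classic.
Proof.
elim: N => [|N IH].
  under eq_fun do rewrite big_geq// Normc.normc0.
  exact: cvg_cst.
have [M hM] := normc_wzG_le _ a a_nat N.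
apply: (@squeeze_cvgr _ _ _ _ (fun=> 0)
  (fun K => Normc.normc (\sum_(0 <= n < N) wzG a n K) + M * harmonic K)).
- apply: nearW => K; rewrite normc_ge0/= big_nat_recr//=.
  by rewrite (le_trans (normcD _ _))// lerD2l.
- exact: cvg_cst.
- rewrite -[X in (_ --> X)%classic](addr0 (0 : R)); apply: cvgD => //.
  by rewrite -(mulr0 M); apply: cvgMr; exact: cvg_harmonic.
Qed.

Lemma cvg_wz_series : exists S : R[i],
  (Normc.normc (\sum_(0 <= k < K) wzF a 0 k - S) @[K --> \oo] --> (0 : R))%classic /\
  (Normc.normc (\sum_(0 <= n < N) wzG a n 0 - S) @[N --> \oo] --> (0 : R))%classic.
Proof.
have [C C0 hC] := normc_wzF_le _ a a_nat.
have [|S hS] := @complex_series_exists R (wzF a 0) C.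
  by move=> k; apply: le_trans (hC 0%N k) _; rewrite mulr1.
exists S; split=> //.
(* With N fixed, [wz_sum] bounds the left side by [u K] for every K, and K tends to infinity. The
   factor 2 bounds the sum of the inverse squares. *)
have bound N : Normc.normc (\sum_(0 <= n < N) wzG a n 0 - S) <= C * 2 * 2^-1 ^+ N.
  pose u K := Normc.normc (\sum_(0 <= k < K) wzF a 0 k - S)
    + Normc.normc (\sum_(0 <= n < N) wzG a n K) + C * 2 * 2^-1 ^+ N.
  have cu : (u K @[K --> \oo] --> 0 + 0 + C * 2 * 2^-1 ^+ N)%classic.
    apply: cvgD; last exact: cvg_cst.
    by apply: cvgD => //; exact: cvg_normc_wzG_sum.
  rewrite -[leRHS]add0r -[X in _ <= X + _]addr0 -(cvg_lim _ cu)//.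
  apply: limr_ge; first by apply/cvg_ex; exists (0 + 0 + C * 2 * 2^-1 ^+ N).
  apply: nearW => K; rewrite /u (wz_sum _ a a_nat N K).
  set x := \sum_(0 <= k < K) wzF a 0 k; set y := \sum_(0 <= k < K) wzF a N k.
  set z := \sum_(0 <= n < N) wzG a n K.
  have -> : x - y + z - S = (x - S) + z - y by ring.
  rewrite (le_trans (normcD _ _))// normc_opp lerD ?normcD//.
  apply: le_trans (normc_sum _ _ _) _.
  apply: (@le_trans _ _ (\sum_(0 <= k < K) C * 2^-1 ^+ N * (k.+1%:R ^+ 2)^-1)).
    by apply: ler_sum => k _; exact: hC.
  rewrite -mulr_sumr [leRHS]mulrAC; apply: ler_wpM2l (sum_inv_sqr_le _ _).
  by rewrite mulr_ge0// exprn_ge0.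
apply: (@squeeze_cvgr _ _ _ _ (fun=> 0) (fun N => C * 2 * 2^-1 ^+ N)).
- by apply: nearW => N; rewrite normc_ge0/=.
- exact: cvg_cst.
- rewrite -(mulr0 (C * 2)); apply: cvgMr; apply: cvg_expr.
  by rewrite ger0_norm ?invr_ge0// invf_lt1// ltr1n.
Qed.

End WZLimit.

(** * The series identity *)

Theorem theorem4 (R : realType) (a : R[i])
    (ha : forall z : int, z != 0 -> a != z%:~R) :
  exists S T : R[i],
    [/\ complex_series_sum
          (fun k : nat => 1 / (k%:R * (k%:R ^+ 2 - a ^+ 2))) S,
        complex_series_sum
          (fun n : nat =>
             (-1) ^+ n.-1 / (n%:R ^+ 3 * 'C(2 * n, n)%:R ^+ 5)
             * (p n a / ((n%:R ^+ 2 - a ^+ 2) * (4 * n%:R ^+ 2 - a ^+ 2)))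
             * \prod_(1 <= m < n)
                 ((1 - a ^+ 2 / m%:R ^+ 2) ^+ 2
                  / (1 - a ^+ 2 / (n + m)%:R ^+ 2))) T
      & S = 2 * T].
Proof.
(* From j^2 - a^2 = (j - a)(j + a), with [ha] used at j and at -j. *)
have a_nat (j : nat) : (0 < j)%N -> j%:R ^+ 2 - a ^+ 2 != 0.
  move=> j0; rewrite subr_sqr mulrC mulf_neq0//; last first.
    by rewrite subr_eq0 eq_sym (ha j%:Z)// eqz_nat -lt0n.
  have -> : j%:R + a = a - (- j%:Z)%:~R by rewrite mulrNz opprK addrC.
  by rewrite subr_eq0 (ha (- j%:Z))// oppr_eq0 eqz_nat -lt0n.
have [S [hF hG]] := cvg_wz_series R a a_nat.
(* The common limit [S] is twice the left-hand series, as F(0,k) carries a factor 2, and four times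
   the right-hand one, as G(n,0) carries a factor 4. *)
exists (S / 2), (S / 4); split.
- apply: complex_series_sum_scaled hF; first by rewrite pnatr_eq0.
  by move=> k; exact: wzF0.
- apply: complex_series_sum_scaled hG; first by rewrite pnatr_eq0.
  by move=> n; exact: wzG0.
- by field.
Qed.
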